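(* Let $A$ be an associative algebra over an algebraically closed field $\mathbb{F}$ of characteristic zero, and suppose $A$ admits minimal regular gradings by finite abelian groups $G$ and $H$. Then: 1. $|G|=|H|$ and this number equals $\exp(A)$. In particular $A$ is a PI-algebra. 2. The commutation matrices $M_G^A$ and $M_H^A$ are conjugate. In particular $\mathrm{tr}(M_G^A)=\mathrm{tr}(M_H^A)$ and $\det(M_G^A)=\det(M_H^A)$. 3. In fact, $\det(M_G^A)=\pm|G|^{|G|/2}$.
   Context: A $G$-grading on $A$ is a vector space decomposition $A=\bigoplus_{g\in G}A_g$ with $A_gA_h\subseteq A_{gh}$. For $G$ finite abelian, the grading is regular if there is a function $\theta:G\times G\to\mathbb{F}^\times$ (the commutation function) such that (i) for every $n\ge 1$ and $(g_1,\dots,g_n)\in G^n$ there are $a_i\in A_{g_i}$ with $a_1\cdots a_n\neq 0$; (ii) $ab=\theta(g,h)\,ba$ for all $g,h\in G$, $a\in A_g$, $b\in A_h$. It is minimal if for every $e\ne g\in G$ there is $g'\in G$ with $\theta(g,g')\neq 1$. The commutation matrix of a regular $G$-grading is the $|G|\times|G|$ matrix $M_G^A$ over $\mathbb{F}$ indexed by $G\times G$ with entries $(M_G^A)_{g,h}=\theta(g,h)$ (after fixing an ordering of $G$, used for both rows and columns). Conjugate means similar over $\mathbb{F}$. $|G|^{|G|/2}$ means $(\sqrt{|G|})^{|G|}$. $Id(A)$ is the T-ideal of (ordinary) polynomial identities of $A$ over $\mathbb{F}$. $A$ is PI if it satisfies a nonzero polynomial identity. With $P_n$ the $n!$-dimensional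 space of multilinear polynomials in $x_1,\dots,x_n$, put $c_n(A)=\dim_{\mathbb{F}}\big(P_n/(P_n\cap Id(A))\big)$; the exponent is $\exp(A)=\lim_{n\to\infty}c_n(A)^{1/n}$ (for PI-algebras this limit exists and is a nonnegative integer, by Giambruno and Zaicev). *)

(* Defs.v *)
From HB Require Import structures.
From mathcomp Require Import all_boot all_order all_fingroup all_algebra.
From mathcomp Require Import all_classical all_reals all_analysis.
From mathcomp Require Import sesquilinear finmap.
From mathcomp Require Import -(notations) monalg.

Set Implicit Arguments.
Unset Strict Implicit.
Unset Printing Implicit Defensive.

Import GRing.Theory numFieldNormedType.Exports.

Local Open Scope ring_scope.

(* Associative algebras, not assumed unital, commutative or
   finite-dimensional. *)
Record assocAlg (F : fieldType) := AssocAlg {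
  alg_sort :> lmodType F;
  amul : {bilinear alg_sort -> alg_sort -> alg_sort};
  amulA : associative amul
}.

Arguments amul {F a}.
Arguments amulA {F a}.

(* a_1 * ... * a_n for n >= 1; the value on the empty sequence is junk. *)
Definition aprod (F : fieldType) (A : assocAlg F) (s : seq A) : A :=
  if s is a :: s' then foldl amul a s' else 0.

Section Gradings.
Variables (F : fieldType) (A : assocAlg F) (G : finGroupType).

Record is_grading (gr : G -> set A) : Prop := IsGrading {
  grading0 : forall g, gr g 0;
  gradingP : forall g (c : F) a b, gr g a -> gr g b -> gr g (c *: a + b);
  grading_decomp : forall a : A,
    exists! f : {ffun G -> A}, (forall g, gr g (f g)) /\ \sum_g f g = a;
  gradingM : forall g h a b, gr g a -> gr h b -> gr (g * h)%g (amul a b)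
}.

(* The commutation function theta is exhibited; on a regular grading it is
   unique. *)
Record is_regular_grading (gr : G -> set A) (theta : G -> G -> F) : Prop :=
  IsRegularGrading {
  regular_grading : is_grading gr;
  regular_theta_neq0 : forall g h, theta g h != 0;
  regular_prod_neq0 : forall n, (0 < n)%N -> forall g : 'I_n -> G,
    exists a : 'I_n -> A,
      (forall i, gr (g i) (a i)) /\ aprod [seq a i | i <- enum 'I_n] <> 0;
  regular_comm : forall g h a b, gr g a -> gr h b ->
    amul a b = theta g h *: amul b a
}.

Definition is_minimal (theta : G -> G -> F) : Prop :=
  forall g : G, g != 1%g -> exists g' : G, theta g g' != 1.

(* A bijection e : 'I_n -> G is an ordering of G, used for rows and columns. *)
Definition commutation_mx (theta : G -> G -> F) n (e : 'I_n -> G) : 'M[F]_n :=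
  \matrix_(i, j) theta (e i) (e j).

End Gradings.

(* The free unital associative algebra on x_0, x_1, x_2, ... *)
Definition freeAlg (F : fieldType) := malg (fmonom nat) F.

Section Identities.
Variables (F : fieldType) (A : assocAlg F).

Definition eval_poly (x : nat -> A) (f : freeAlg F) : A :=
  \sum_(m <- msupp f) mcoeff m f *: aprod [seq x i | i <- (m : seq nat)].

(* As A need not have a unit, identities are taken among the polynomials
   without constant term; a unital A <> 0 has no others. *)
Definition is_identity (f : freeAlg F) : Prop :=
  mcoeff (FMonom [::]) f = 0 /\ forall x : nat -> A, eval_poly x f = 0.

Definition is_PI : Prop := exists f : freeAlg F, f != 0 /\ is_identity f.

(* P_n in coordinates over its monomial basis: c stands for
   \sum_s c_s x_(s 0) ... x_(s (n-1)). *)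
Definition multilin n : vectType F := {ffun 'S_n -> F^o}.

Definition multilin_poly n (c : multilin n) : freeAlg F :=
  \sum_(s : 'S_n)
    mkmalgU (FMonom [seq (s i : nat) | i <- enum 'I_n]) (c s : F).

Definition multilin_id n : {vspace multilin n} :=
  xget 0%VS [set W : {vspace multilin n} |
    forall c, c \in W <-> is_identity (multilin_poly c)].

Lemma eval_polyE (x : nat -> A) (E : {fset fmonom nat}) (f : freeAlg F) :
  (msupp f `<=` E)%fset ->
  eval_poly x f =
    \sum_(m <- E) mcoeff m f *: aprod [seq x i | i <- (m : seq nat)].
Proof.
move=> sfE; rewrite /eval_poly (big_fset_incl _ sfE) // => m _ mf.
by rewrite mcoeff_outdom ?scale0r.
Qed.

Lemma eval_polyP (x : nat -> A) (k : F) (f g : freeAlg F) :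
  eval_poly x (k *: f + g) = k *: eval_poly x f + eval_poly x g.
Proof.
pose E := (msupp f `|` msupp g `|` msupp (k *: f + g))%fset.
have [sf sg] : (msupp f `<=` E)%fset /\ (msupp g `<=` E)%fset.
  by split; apply/fsubsetP => m mE; rewrite !in_fsetU mE ?orbT.
rewrite (@eval_polyE x E) ?fsubsetUr // (eval_polyE _ sf) (eval_polyE _ sg).
rewrite scaler_sumr -big_split; apply: eq_bigr => m _ /=.
by rewrite mcoeffD mcoeffZ scalerDl scalerA.
Qed.

Lemma multilin_polyP n (k : F) (c d : multilin n) :
  multilin_poly (k *: c + d) = k *: multilin_poly c + multilin_poly d.
Proof.
rewrite /multilin_poly scaler_sumr -big_split; apply: eq_bigr => s _ /=.
apply/malgP => m; rewrite !ffunE mcoeffD mcoeffZ !mcoeffU.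
by case: (_ == m); rewrite ?mulr1n // !mulr0n mulr0 addr0.
Qed.

(* The subspace that multilin_id picks does exist. *)
Lemma multilin_idP n (c : multilin n) :
  c \in multilin_id n <-> is_identity (multilin_poly c).
Proof.
suff [W WP] : exists W : {vspace multilin n},
    forall d, d \in W <-> is_identity (multilin_poly d).
  by rewrite /multilin_id; case: xgetP => [V _ VP|/(_ W) //]; exact: VP.
have idP k (d e : multilin n) : is_identity (multilin_poly d) ->
    is_identity (multilin_poly e) -> is_identity (multilin_poly (k *: d + e)).
  rewrite multilin_polyP => -[d0 dx] [e0 ex]; split=> [|x].
    by rewrite mcoeffD mcoeffZ d0 e0 mulr0 addr0.
  by rewrite eval_polyP dx ex scaler0 addr0.
have id0 : is_identity (multilin_poly (0 : multilin n)).
  have -> : multilin_poly (0 : multilin n) = 0.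
    by rewrite /multilin_poly big1 // => s _; rewrite ffunE monalgU0.
  split=> [|x]; first by rewrite mcoeff0.
  by rewrite /eval_poly msupp0 big_seq_fset0.
pose Q m := `[< exists2 W : {vspace multilin n}, \dim W = m &
  forall d, d \in W -> is_identity (multilin_poly d) >].
have exQ : exists m, Q m.
  exists 0%N; apply/asboolP; exists 0%VS; first exact: dimv0.
  by move=> d; rewrite memv0 => /eqP->.
have Qle m : Q m -> (m <= \dim {:multilin n})%N.
  by move=> /asboolP[W <- _]; rewrite dimvS ?subvf.
case: (ex_maxnP exQ Qle) => m /asboolP[W <- WQ] mmax.
exists W => d; split=> [|idd]; first exact: WQ.
have dU : (\dim (W + <[d]>) <= \dim W)%N.
  apply: mmax; apply/asboolP; exists (W + <[d]>)%VS; first exact: erefl.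
  move=> e /memv_addP[w wW [v /vlineP[k ->] ->]].
  by rewrite addrC; apply: idP; [exact: idd|exact: WQ].
have eW : W = (W + <[d]>)%VS by apply/eqP; rewrite eqEdim addvSl.
by rewrite eW; apply: (subvP (addvSr _ _)); exact: memv_line.
Qed.

Definition codim n : nat := (\dim {:multilin n} - \dim (multilin_id n))%N.

Definition codim_root (R : realType) (n : nat) : R :=
  ((codim n)%:R : R) `^ (n%:R^-1).

Definition PI_exp (R : realType) : R := limn (codim_root R).

End Identities.

(* Main.v *)
Require Import Defs.
From HB Require Import structures.
From mathcomp Require Import all_boot all_order all_fingroup all_algebra.
From mathcomp Require Import all_classical all_reals all_analysis.
From mathcomp Require Import sesquilinear finmap.
From mathcomp Require Import -(notations) monalg.
From mathcomp Require Import zify ring lra.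

Set Implicit Arguments.
Unset Strict Implicit.
Unset Printing Implicit Defensive.

Import Order.TTheory GRing.Theory Num.Theory numFieldNormedType.Exports.

Local Open Scope ring_scope.

(** The commutation function theta of a regular grading is a skew bicharacter
    (regular_skew_bicharacter). When it is minimal the characters theta g are
    orthogonal, so the commutation matrix M satisfies M M is |G| times the
    identity (sqr_commutation_mx). This alone gives det M = +- |G|^(|G|/2), and
    it makes M diagonalizable with eigenvalues +- sqrt |G|: in characteristic 0
    the conjugacy class of M is then determined by |G| and the trace
    (sqr_scalar_simmx). The trace is |G| or 0 according to whether the sign
    character g |-> theta g g is trivial or not (tr_commutation_mx). It remains
    to read off |G| and the triviality of this character from the identities
    of A.

    The sign character is trivial exactly when the standard polynomial of
    degree |G| + 1 is an identity (standard_diag).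

    The number |G| is the exponent. Reordering a product of homogeneous elements
    of degrees d multiplies it by an explicit scalar, so a multilinear
    polynomial is an identity if and only if it is orthogonal to the functions
    sending a permutation to this scalar, for all d
    (identity_twist, twist_identity). Hence the n-th codimension is
    the rank of these |G|^n functions on permutations, which gives the upper
    bound |G|^n and, since |G|^n < n! for some n, a polynomial identity.

    For the lower bound, permute m letters y_i placed between fixed letters
    z_j. Summing over the degrees of the z_j against characters detects the
    degrees of all the prefixes of the word in the y_i (sum_detector). The
    functions so obtained, after rescaling, form a matrix with entries 0 and
    +-1 whose rows are permutations s and whose columns are pairs (d, c) of
    words in G, the entry being nonzero when d o s = c. The rank of such a
    matrix is bounded below over the rationals by Cauchy-Schwarz for its Gram
    matrix (sqr_mxtrace_le_rank), whatever the signs are; orbit counting for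
    the action of permutations on words makes the bound |G|^(2m) divided by a
    polynomial in m (sign_matrix_rank). With n about 2m this has the same
    exponential growth as the upper bound (codim_ge, codim_root_cvg). *)

(** * Linear algebra *)

Lemma pcharf0_natr (F : fieldType) (n : nat) :
  [pchar F] =i pred0 -> (n%:R == 0 :> F) = (n == 0%N).
Proof. by move=> /pcharf0P ->. Qed.

Lemma idempotent_factor (F : fieldType) n (E : 'M[F]_n) :
  E *m E = E ->
  exists C : 'M[F]_(n, \rank E), exists R : 'M[F]_(\rank E, n),
    E = C *m R /\ R *m C = 1%:M.
Proof.
move=> EE; exists (col_base E), (row_base E); split; first by rewrite mulmx_base.
apply: (row_full_inj (col_base_full E)); apply: (row_free_inj (row_base_free E)).
by rewrite mulmx1 mulmx_base mulmxA mulmx_base -mulmxA mulmx_base.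
Qed.

Lemma idempotent_tr (F : fieldType) n (E : 'M[F]_n) :
  E *m E = E -> \tr E = (\rank E)%:R.
Proof.
by move=> /idempotent_factor[C [R [EC RC]]]; rewrite {1}EC mxtrace_mulC RC mxtrace1.
Qed.

(** Equal traces give equal ranks in characteristic 0. The base change maps
    the image and the kernel of one idempotent onto those of the other. *)
Lemma idempotent_similar (F : fieldType) n (E E' : 'M[F]_n) :
  [pchar F] =i pred0 -> E *m E = E -> E' *m E' = E' -> \tr E = \tr E' ->
  exists2 P : 'M[F]_n, P \in unitmx & P *m E = E' *m P.
Proof.
move=> F0 EE EE' tE.
have compl (D : 'M[F]_n) : D *m D = D -> (1%:M - D) *m (1%:M - D) = 1%:M - D.
  by move=> DD; rewrite mulmxBl mul1mx mulmxBr mulmx1 DD subrr subr0.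
have rkE (D D' : 'M[F]_n) : D *m D = D -> D' *m D' = D' -> \tr D = \tr D' ->
    \rank D = \rank D'.
  move=> DD DD'; rewrite !idempotent_tr // => /eqP.
  by rewrite -subr_eq0; case: (leqP (\rank D) (\rank D')) => le;
     [rewrite -oppr_eq0 opprB -natrB // | rewrite -natrB 1?ltnW //];
     rewrite pcharf0_natr // => /eqP; lia.
have r1 := rkE _ _ EE EE' tE.
have r2 : \rank (1%:M - E) = \rank (1%:M - E').
  by apply: rkE; rewrite ?compl // !linearB /= tE.
have [C [Q [EC QC]]] := idempotent_factor EE.
have [D [S [ED SD]]] := idempotent_factor (compl _ EE).
have := idempotent_factor EE'; rewrite -r1 => -[C' [Q' [EC' QC']]].
have := idempotent_factor (compl _ EE'); rewrite -r2 => -[D' [S' [ED' SD']]].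
have orth k l (X : 'M[F]_n) (c : 'M[F]_(n, k)) (r : 'M[F]_(k, n)) (d : 'M[F]_(n, l))
    (s : 'M[F]_(l, n)) : X *m X = X -> X = c *m r -> r *m c = 1%:M ->
    1%:M - X = d *m s -> s *m d = 1%:M -> r *m d = 0 /\ s *m c = 0.
  move=> XX Xc rc Xd sd; split.
    have : r *m (X *m (1%:M - X)) *m d = 0.
      by rewrite mulmxBr mulmx1 XX subrr mulmx0 mul0mx.
    by rewrite Xd Xc !mulmxA rc mul1mx -!mulmxA sd mulmx1.
  have : s *m ((1%:M - X) *m X) *m c = 0.
    by rewrite mulmxBl mul1mx XX subrr mulmx0 mul0mx.
  by rewrite Xd Xc !mulmxA sd mul1mx -!mulmxA rc mulmx1.
have [QD SC] := orth _ _ _ _ _ _ _ EE EC QC ED SD.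
have [QD' SC'] := orth _ _ _ _ _ _ _ EE' EC' QC' ED' SD'.
(* E = C Q and 1 - E = D S are rank factorizations, likewise with primes;
   the inverse of the base change is C Q' + D S'. *)
exists (C' *m Q + D' *m S).
  suff : (C' *m Q + D' *m S) *m (C *m Q' + D *m S') = 1%:M.
    by case/mulmx1_unit.
  rewrite mulmxDl !mulmxDr -!mulmxA !(mulmxA Q) !(mulmxA S) QC QD SC SD.
  rewrite !mul0mx !mul1mx !mulmx0 addr0 add0r -EC' -ED'.
  by rewrite addrC subrK.
have := congr1 (mulmx Q) EC; have := congr1 (mulmx S) EC.
have := congr1 (mulmx^~ C') EC'; have := congr1 (mulmx^~ D') EC'.
rewrite -!mulmxA !(mulmxA Q) !(mulmxA S) QC SC QC' QD'.
rewrite mulmx0 mulmx1 mul1mx mul0mx => ED'0 EC'1 SE QE.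
by rewrite mulmxDl mulmxDr -!mulmxA SE QE !mulmxA EC'1 ED'0 mulmx0 mul0mx.
Qed.

(** If r is a square root of a, then (1 + A / r) / 2 is the projector onto the
    eigenspace of r. Its trace, hence its conjugacy class, is determined by the
    trace of A. *)
Lemma sqr_scalar_simmx (F : closedFieldType) n (a : F) (A B : 'M[F]_n) :
  [pchar F] =i pred0 -> a != 0 -> A *m A = a%:M -> B *m B = a%:M ->
  \tr A = \tr B -> A ~_{in unitmx} B.
Proof.
move=> F0 a0 AA BB tAB.
have [r r2] : exists r : F, r ^+ 2 = a.
  have := @solve_monicpoly F 2 (fun i => if i == 0%N then a else 0) isT.
  by case=> r; rewrite big_ord_recl big_ord1 /= expr0 mulr1 mul0r addr0 => e; exists r.
have r0 : r != 0 by apply: contra_neq a0 => r0; rewrite -r2 r0 expr0n.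
have two0 : (2%:R : F) != 0 by rewrite pcharf0_natr.
pose E (X : 'M[F]_n) := 2^-1 *: (1%:M + r^-1 *: X).
have EE X : X *m X = a%:M -> E X *m E X = E X.
  move=> XX; rewrite /E; set Y := _ *: X.
  have YY : Y *m Y = 1%:M.
    rewrite -scalemxAl -scalemxAr XX -r2 -(scalemx1 _ (r ^+ 2)) !scalerA.
    by rewrite -mulrA expr2 mulKf // mulVf // scale1r.
  rewrite -scalemxAl -scalemxAr mulmxDl mul1mx mulmxDr mulmx1 YY.
  rewrite [Y + _]addrC -mulr2n -scaler_nat scalerA -[_^-1 * _]/(2^-1 * 2).
  by rewrite mulVf // scale1r.
have tE : \tr (E A) = \tr (E B) by rewrite /E !linearZ /= !linearD /= !linearZ /= tAB.
have [P Pu PE] := idempotent_similar F0 (EE _ AA) (EE _ BB) tE.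
exists P => //; apply/simmxP => //.
have inv X : X = r *: (2 *: E X - 1%:M).
  by rewrite /E scalerA mulfV // scale1r addrC addKr scalerA mulfV // scale1r.
rewrite (inv A) (inv B) -scalemxAr -scalemxAl mulmxBr mulmxBl mulmx1 mul1mx.
by rewrite -scalemxAr -scalemxAl PE.
Qed.

Lemma mxtrace_sqr_ge0 (R : realFieldType) m n (X : 'M[R]_(m, n)) :
  0 <= \tr (X *m X^T).
Proof.
apply: sumr_ge0 => i _; rewrite mxE; apply: sumr_ge0 => j _.
by rewrite mxE -expr2 sqr_ge0.
Qed.

(** If v U U^T = 0 then v U U^T v^T is a sum of squares that vanishes. *)
Lemma row_free_gram (R : realFieldType) m n (U : 'M[R]_(m, n)) :
  row_free U -> U *m U^T \in unitmx.
Proof.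
move=> Uf; rewrite -row_free_unit -kermx_eq0; apply/rowV0P => v.
rewrite sub_kermx => /eqP vUU.
have : \sum_j ((v *m U) 0 j) ^+ 2 = 0.
  transitivity ((v *m U *m (v *m U)^T) 0 0).
    by rewrite mxE; apply: eq_bigr => j _; rewrite [_^T _ _]mxE expr2.
  by rewrite trmx_mul mulmxA -(mulmxA v) vUU mul0mx mxE.
move=> /eqP; rewrite psumr_eq0 => [/allP vU0|j _]; last exact: sqr_ge0.
apply: (row_free_inj Uf); rewrite mul0mx; apply/rowP => j; rewrite [RHS]mxE.
by have := vU0 j (mem_index_enum _); rewrite sqrf_eq0 => /eqP.
Qed.

(** The orthogonal projector onto the row space of K has trace equal to the
    rank, so this is the Cauchy-Schwarz inequality between K and it. *)
Lemma sqr_mxtrace_le_rank (R : realFieldType) n (K : 'M[R]_n) :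
  (\tr K) ^+ 2 <= (\rank K)%:R * \tr (K *m K^T).
Proof.
have [U Uf KU] : exists2 U : 'M[R]_(\rank K, n), row_free U & col_base K *m U = K.
  by exists (row_base K); [exact: row_base_free | exact: mulmx_base].
have Uu := row_free_gram Uf.
pose P := U^T *m invmx (U *m U^T) *m U.
have trP : \tr P = (\rank K)%:R.
  by rewrite /P mxtrace_mulC mulmxA mulmxV // mxtrace1.
have UP : U *m P = U by rewrite /P !mulmxA mulmxV // mul1mx.
have KP : K *m P = K.
  by rewrite -{1 2}KU -mulmxA UP.
have PT : P^T = P.
  by rewrite /P !trmx_mul trmxK trmx_inv trmx_mul trmxK mulmxA.
have PP : P *m P = P.
  by rewrite {1}/P -mulmxA UP.
have [k0|k_gt0] := posnP (\rank K).
  by have /eqP := k0; rewrite mxrank_eq0 => /eqP ->; rewrite mxtrace0 expr0n /= mulr_ge0 ?ler0n ?mxtrace_sqr_ge0.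
have kp : (0 : R) < (\rank K)%:R by rewrite ltr0n.
set k : R := _%:R in kp *; pose t := \tr K / k.
(* t *: P is the multiple of P nearest to K. *)
have := mxtrace_sqr_ge0 (K - t *: P).
have -> : (K - t *: P)^T = K^T - t *: P by rewrite linearB /= linearZ /= PT.
rewrite mulmxBl !mulmxBr -!scalemxAr -!scalemxAl KP PP.
have PK : \tr (P *m K^T) = \tr K.
  by rewrite -{1}PT -trmx_mul mxtrace_tr KP.
rewrite !linearB /= !linearZ /= trP -/k PK.
move=> ge; rewrite mulrC -ler_pdivrMr //.
have tk : t * k = \tr K by rewrite /t mulfVK ?gt_eqF.
have -> : (\tr K) ^+ 2 / k = t * \tr K by rewrite expr2 mulrAC.
have scE (a b : R) : a *: (b : R^o) = a * b by [].
by move: ge; rewrite !scE opprK tk; lra.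
Qed.

Lemma mxrank_minor (F : fieldType) m n (A : 'M[F]_(m, n)) :
  exists f : 'I_(\rank A) -> 'I_m, exists g : 'I_(\rank A) -> 'I_n,
    mxsub f g A \in unitmx.
Proof.
pose f := maxrankfun A; pose C := (rowsub f A)^T.
have rC : \rank C = \rank A.
  by rewrite mxrank_tr; apply/eqP; rewrite -/(row_free _) maxrowsub_free.
move: (maxrankfun C) (maxrowsub_free C); rewrite rC => g gf.
exists f, g; rewrite -unitmx_tr -row_free_unit.
by rewrite (_ : _^T = rowsub g C) //; apply/matrixP => i j; rewrite !mxE.
Qed.

(** A minor that is nonzero over the rationals is a nonzero integer, and stays
    nonzero in characteristic 0. *)
Lemma rank_int_le (F : fieldType) m n (B : 'M[int]_(m, n)) :
  [pchar F] =i pred0 ->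
  (\rank (map_mx intr B : 'M[rat]_(m, n)) <=
   \rank (map_mx intr B : 'M[F]_(m, n)))%N.
Proof.
move=> F0; have [f [g]] := mxrank_minor (map_mx intr B : 'M[rat]_(m, n)).
rewrite -map_mxsub unitmxE det_map_mx unitfE intr_eq0 => det0.
have : mxsub f g (map_mx intr B : 'M[F]_(m, n)) \in unitmx.
  rewrite -map_mxsub unitmxE det_map_mx unitfE; move: det0.
  case: (\det _) => d d0; first by rewrite -[X in X != 0]/(d%:R : F) pcharf0_natr.
  by rewrite -[X in X != 0]/(- d.+1%:R : F) oppr_eq0 pcharf0_natr.
rewrite -row_free_unit => /eqP {1}<-.
set A : 'M[F]_(m, n) := map_mx _ _.
rewrite (_ : mxsub f g A = rowsub f 1%:M *m (A *m colsub g 1%:M)).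
  exact: leq_trans (mxrankM_maxr _ _) (mxrankM_maxl _ _).
by rewrite mulmx_colsub mulmx1 mul_rowsub_mx mul1mx; apply/matrixP=> i j; rewrite !mxE.
Qed.

(** The matrix factors through the coordinates in a complement of W. *)
Lemma rank_functionals_le (F : fieldType) (V : vectType F) (W : {vspace V})
    (k l : nat) (u : 'I_k -> V) (f : 'I_l -> V -> F) :
  (forall j c v w, f j (c *: v + w) = c * f j v + f j w) ->
  (forall j w, w \in W -> f j w = 0) ->
  (\rank (\matrix_(i, j) f j (u i)) <= \dim {:V} - \dim W)%N.
Proof.
move=> flin fW.
have f0 j : f j 0 = 0 by apply: fW; rewrite mem0v.
have fD j v w : f j (v + w) = f j v + f j w.
  by rewrite -{1}(scale1r v) flin mul1r.
have fZ j c v : f j (c *: v) = c * f j v.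
  by rewrite -[c *: v]addr0 flin f0 addr0.
have fsum j I (r : seq I) (v : I -> V) :
    f j (\sum_(i <- r) v i) = \sum_(i <- r) f j (v i).
  by elim: r => [|i r ih]; rewrite ?big_nil // !big_cons fD ih.
rewrite -dimv_compl; set b := vbasis W^C%VS.
pose X := \matrix_(i < k, j < \dim W^C) coord b j (u i - projv W (u i)).
pose Y := \matrix_(i < \dim W^C, j < l) f j b`_i.
suff -> : \matrix_(i, j) f j (u i) = X *m Y.
  exact: leq_trans (mxrankM_maxl _ _) (rank_leq_col _).
apply/matrixP => i j; rewrite !mxE -[u i in LHS](subrK (projv W (u i))).
rewrite fD (fW j (projv W _)) ?memv_proj // addr0.
rewrite [in LHS](coord_vbasis (memv_projC W (u i))) fsum.
by apply: eq_bigr => a _; rewrite fZ !mxE.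
Qed.

(** * The commutation function and its matrix *)

Definition skew_bicharacter (F : fieldType) (G : finGroupType)
    (theta : G -> G -> F) : Prop :=
  (forall g h, theta g h * theta h g = 1) /\
  (forall g h k, theta (g * h)%g k = theta g k * theta h k).

Section Bicharacter.
Variables (F : fieldType) (G : finGroupType) (theta : G -> G -> F).
Hypothesis bi : skew_bicharacter theta.

Lemma skew_sym g h : theta g h * theta h g = 1. Proof. by case: bi. Qed.

Lemma skewMl g h k : theta (g * h)%g k = theta g k * theta h k.
Proof. by case: bi. Qed.

Lemma skew_neq0 g h : theta g h != 0.
Proof.
by apply: contra_eq_neq (skew_sym g h) => ->; rewrite mul0r eq_sym oner_eq0.
Qed.

Lemma skewV g h : (theta g h)^-1 = theta h g.
Proof. by apply: (mulfI (skew_neq0 g h)); rewrite mulfV ?skew_neq0 ?skew_sym. Qed.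

Lemma skewMr g h k : theta k (g * h)%g = theta k g * theta k h.
Proof. by rewrite -skewV skewMl invfM !skewV. Qed.

Lemma skew1l g : theta 1%g g = 1.
Proof.
by apply: (mulfI (skew_neq0 1%g g)); rewrite -skewMl mulg1 mulr1.
Qed.

Lemma skewVl g h : theta g^-1%g h = (theta g h)^-1.
Proof.
by apply: (mulfI (skew_neq0 g h)); rewrite -skewMl mulgV skew1l mulfV ?skew_neq0.
Qed.

Lemma skew_diag g : theta g g = 1 \/ theta g g = -1.
Proof.
have := skew_sym g g; rewrite -expr2 => /eqP.
by rewrite sqrf_eq1 => /orP[]/eqP; [left | right].
Qed.

(** The diagonal of a skew bicharacter is a linear character with values in
    {1, -1}; it sums to 0 unless it is trivial. *)
Lemma sum_skew_diag :
  \sum_g theta g g = if [forall g, theta g g == 1] then #|G|%:R else 0.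
Proof.
have diagM g h : theta (g * h)%g (g * h)%g = theta g g * theta h h.
  by rewrite skewMl !skewMr mulrA -(mulrA (theta g g)) skew_sym mulr1.
case: ifPn => [/forallP t1|].
  by rewrite (eq_bigr (fun=> 1)) ?sumr_const // => g _; exact/eqP.
rewrite negb_forall => /existsP[g0 t0]; set S := \sum_g _.
have : S = theta g0 g0 * S.
  rewrite {1}/S (reindex_inj (mulgI g0)) mulr_sumr; apply: eq_bigr => g _.
  exact: diagM.
move/eqP; rewrite -subr_eq0 -{1}(mul1r S) -mulrBl mulf_eq0 subr_eq0 eq_sym.
by rewrite (negPf t0) => /eqP.
Qed.

Hypothesis mini : is_minimal theta.

Lemma sum_skew g : \sum_h theta g h = #|G|%:R * (g == 1%g)%:R.
Proof.
have [->|/mini[h0 t0]] := eqVneq g 1%g.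
  by rewrite mulr1 (eq_bigr (fun=> 1)) ?sumr_const // => h _; rewrite skew1l.
rewrite mulr0; set S := \sum_h _; have : S = theta g h0 * S.
  rewrite {1}/S (reindex_inj (mulgI h0)) mulr_sumr; apply: eq_bigr => h _.
  exact: skewMr.
move/eqP; rewrite -subr_eq0 -{1}(mul1r S) -mulrBl mulf_eq0 subr_eq0 eq_sym.
by rewrite (negPf t0) => /eqP.
Qed.

(** Orthogonality of the characters theta g. *)
Lemma sqr_commutation_mx n (e : 'I_n -> G) : bijective e ->
  commutation_mx theta e *m commutation_mx theta e = #|G|%:R%:M.
Proof.
move=> eb; apply/matrixP => i j; rewrite !mxE.
rewrite (eq_bigr (fun k => theta (e i * (e j)^-1)%g (e k))) => [|k _].
  rewrite -(reindex e (P := xpredT) (F := fun h => theta (e i * (e j)^-1)%g h)) /=.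
    by rewrite sum_skew -eq_mulgV1 (bij_eq eb) mulr_natr; case: eqP.
  exact: onW_bij.
by rewrite !mxE skewMl skewVl skewV.
Qed.

Lemma tr_commutation_mx n (e : 'I_n -> G) : bijective e ->
  \tr (commutation_mx theta e) =
    if [forall g, theta g g == 1] then #|G|%:R else 0.
Proof.
move=> eb; rewrite -sum_skew_diag (reindex e) /=; last exact: onW_bij.
by apply: eq_bigr => i _; rewrite mxE.
Qed.

End Bicharacter.

(** * Products of homogeneous elements *)

Section Products.
Variables (F : fieldType) (A : assocAlg F).

Lemma aprod_cons (a : A) s : s != [::] -> aprod (a :: s) = amul a (aprod s).
Proof.
case: s => // b s _ /=; elim/last_ind: s => // s c ih.
by rewrite !foldl_rcons ih amulA.
Qed.

Lemma aprod_cat (s t : seq A) : s != [::] -> t != [::] ->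
  aprod (s ++ t) = amul (aprod s) (aprod t).
Proof.
elim: s => // a s ih _ t0; have [->|s0] := eqVneq s [::].
  by rewrite cat1s aprod_cons.
rewrite cat_cons aprod_cons ?ih ?aprod_cons ?amulA //.
by case: (s) s0.
Qed.

End Products.

Section RegularGrading.
Variables (F : fieldType) (A : assocAlg F) (G : finGroupType).
Variables (gr : G -> set A) (theta : G -> G -> F).
Hypothesis reg : is_regular_grading gr theta.

Lemma gr_amul g h a b : gr g a -> gr h b -> gr (g * h)%g (amul a b).
Proof. exact: (gradingM (regular_grading reg)). Qed.

Lemma amulZl c (a b : A) : amul (c *: a) b = c *: amul a b.
Proof. exact: linearZl_LR. Qed.

Lemma amulZr c (a b : A) : amul a (c *: b) = c *: amul a b.
Proof. exact: linearZr. Qed.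

(** Both identities compare two ways of reordering a nonzero product of
    homogeneous elements: b a against a b, and c (a b) against (a b) c, where c
    passes a b at once or one factor at a time. *)
Lemma regular_skew_bicharacter : skew_bicharacter theta.
Proof.
have comm := regular_comm reg.
split=> [g h|g h k].
  have [a [aG a0]] := regular_prod_neq0 reg (ltn0Sn 1)
    (fun i : 'I_2 => if i == ord0 then g else h).
  have {}a0 : amul (a ord0) (a (lift ord0 ord0)) <> 0.
    by move: a0; rewrite enum_ordSl enum_ordSl enum_ord0.
  have ag : gr g (a ord0) by have := aG ord0.
  have ah : gr h (a (lift ord0 ord0)) by have := aG (lift ord0 ord0).
  apply/eqP; rewrite -subr_eq0; apply/negPn/negP => t0; apply: a0.
  apply: (scalerI t0); rewrite scaler0 scalerBl scale1r -scalerA.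
  by rewrite -(comm _ _ _ _ ah ag) -(comm _ _ _ _ ag ah) subrr.
have [a [aG a0]] := regular_prod_neq0 reg (ltn0Sn 2)
  (fun i : 'I_3 => if i == ord0 then g else if i == lift ord0 ord0 then h else k).
have [ag ah ak] : [/\ gr g (a ord0), gr h (a (lift ord0 ord0))
    & gr k (a (lift ord0 (lift ord0 ord0)))].
  by split; [have := aG ord0 | have := aG (lift ord0 ord0) | have := aG (lift ord0 (lift ord0 ord0))].
move: a0; rewrite enum_ordSl enum_ordSl enum_ordSl enum_ord0 /=.
move: (a ord0) (a (lift ord0 ord0)) (a (lift ord0 (lift ord0 ord0))) ag ah ak.
move=> x y z xg yh zk xyz0.
have e1 := comm _ _ _ _ (gr_amul xg yh) zk.
have e2 : amul (amul x y) z = (theta g k * theta h k) *: amul z (amul x y).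
  rewrite -amulA (comm _ _ _ _ yh zk) amulZr amulA (comm _ _ _ _ xg zk) amulZl.
  by rewrite scalerA mulrC -amulA.
apply/eqP; rewrite -subr_eq0; apply/negPn/negP => t0; apply: xyz0.
rewrite e1; apply/eqP; rewrite scaler_eq0; apply/orP; right; apply/eqP.
apply: (scalerI t0); rewrite scaler0 scalerBl -e1 -e2 subrr //.
Qed.

End RegularGrading.

(** * Words in homogeneous letters *)

(** When W i j / W j i is the scalar by which the letters i and j commute, the
    product of the letters of a word s without repetitions, divided by
    twist W s, does not depend on their order (twist_perm). *)
Fixpoint twist (F : fieldType) (I : Type) (W : I -> I -> F) (s : seq I) : F :=
  if s is i :: s' then (\prod_(j <- s') W i j) * twist W s' else 1.

Section Twist.
Variables (F : fieldType) (I : eqType) (W : I -> I -> F).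
Hypothesis W0 : forall i j, W i j != 0.

Lemma twist_neq0 s : twist W s != 0.
Proof.
elim: s => [|i s ih] /=; first exact: oner_neq0.
by rewrite mulf_neq0 // prodf_seq_neq0; apply/allP => j _; exact/implyP.
Qed.

Lemma twist_move i t1 t2 :
  twist W (t1 ++ i :: t2) * \prod_(j <- t1) W i j =
  twist W (i :: t1 ++ t2) * \prod_(j <- t1) W j i.
Proof.
elim: t1 => [|j t1]; first by rewrite !big_nil !mulr1.
move=> /=; rewrite !big_cons !big_cat /= !big_cons.
move: (twist W _) (twist W _) => T U.
do 5 move: (\prod_(k <- _) _); move=> X Y V Q R.
move=> e; transitivity (Y * X * W j i * W i j * (U * R)); first by ring.
by rewrite e; ring.
Qed.

Variables (A : assocAlg F) (x : I -> A).
Hypothesis Wx : forall i j, i != j ->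
  W j i *: amul (x i) (x j) = W i j *: amul (x j) (x i).

Lemma aprod_move i t1 t2 : i \notin t1 ->
  (\prod_(j <- t1) W i j) *: aprod (map x (t1 ++ i :: t2)) =
  (\prod_(j <- t1) W j i) *: aprod (map x (i :: t1 ++ t2)).
Proof.
elim: t1 => [|j t1 ih]; first by rewrite !big_nil.
rewrite inE negb_or => /andP[ij /ih{}ih].
rewrite !big_cons cat_cons 2!map_cons aprod_cons; last by case: (t1).
rewrite -scalerA -amulZr ih amulZr scalerA [W i j * _]mulrC -scalerA cat_cons !map_cons.
have e : W i j *: amul (x j) (aprod (x i :: map x (t1 ++ t2))) =
         W j i *: aprod (x i :: x j :: map x (t1 ++ t2)).
  case: (t1 ++ t2) => [|k r]; first exact: esym (Wx ij).
  rewrite map_cons 2?[aprod (x i :: _)]aprod_cons // [aprod (x j :: _)]aprod_cons //.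
  by rewrite !amulA -[LHS]amulZl -[RHS]amulZl (Wx ij).
by rewrite -[LHS]scalerA e scalerA [RHS]scalerA mulrC.
Qed.

Lemma twist_perm s t : uniq s -> perm_eq s t ->
  twist W t *: aprod (map x s) = twist W s *: aprod (map x t).
Proof.
elim: s t => [|i s ih] t.
  by move=> _; rewrite perm_sym => /perm_nilP ->.
have twist_cons k r : twist W (k :: r) = (\prod_(j <- r) W k j) * twist W r by [].
rewrite cons_uniq => /andP[si su] st.
have it : i \in t by rewrite -(perm_mem st) mem_head.
case/splitPr: it st => t1 t2.
rewrite perm_sym perm_catC cat_cons perm_cons perm_catC perm_sym => st.
have it1 : i \notin t1.
  by apply: contra si; rewrite (perm_mem st) mem_cat => ->.
have c0 : \prod_(j <- t1) W i j != 0.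
  by rewrite prodf_seq_neq0; apply/allP => j _; exact/implyP.
apply: (scalerI c0); rewrite scalerA [_ * twist W _]mulrC twist_move !twist_cons.
rewrite (perm_big _ st); set w := \prod_(j <- t1 ++ t2) _.
set c' := \prod_(j <- t1) W j i.
transitivity ((w * twist W s) *: (c' *: aprod (map x (i :: t1 ++ t2)))); last first.
  by rewrite -aprod_move // scalerA [RHS]scalerA; congr (_ *: _); exact: mulrC.
rewrite [RHS]scalerA ![w * _ * c']mulrAC -[LHS]scalerA -[RHS]scalerA.
congr (_ *: _); have [s0|s0] := eqVneq s [::].
  by move: st; rewrite s0 perm_sym => /perm_nilP ->.
have map0 r : r != [::] -> map x r != [::] by case: r.
have t0 : t1 ++ t2 != [::] by rewrite -size_eq0 -(perm_size st) size_eq0.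
rewrite !map_cons !aprod_cons ?map0 //.
by rewrite -[LHS]amulZr -[RHS]amulZr ih.
Qed.

End Twist.

Lemma twist_prod (F : fieldType) (I : Type) (W : I -> I -> F) n (s : 'I_n -> I) :
  twist W [seq s i | i <- enum 'I_n] =
    \prod_(p < n) \prod_(q < n | (p < q)%N) W (s p) (s q).
Proof.
transitivity (\prod_(p <- enum 'I_n) \prod_(q <- enum 'I_n | (p < q)%N) W (s p) (s q)); last first.
  rewrite big_enum; apply: eq_bigr => p _.
  by rewrite big_enum_cond; apply: eq_bigl.
have: sorted (fun p q : 'I_n => (p < q)%N) (enum 'I_n).
  have := iota_ltn_sorted 0 n.
  by rewrite -val_enum_ord sorted_map.
elim: (enum 'I_n) => [|p l ih] pl; first by rewrite big_nil.
have tr : transitive (fun p q : 'I_n => (p < q)%N) by move=> ? ? ?; exact: ltn_trans.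
have pa : all (fun q : 'I_n => (p < q)%N) l by exact: (order_path_min tr pl).
rewrite /= [RHS]big_cons ih ?(path_sorted pl) // big_map big_cons ltnn.
congr (_ * _).
  rewrite big_seq [RHS]big_seq_cond; apply: eq_bigl => q.
  by case ql: (q \in l); rewrite //= (allP pa).
by apply: eq_big_seq => q ql; rewrite big_cons ltnNge ltnW ?(allP pa).
Qed.

(** * Identities of an algebra with a regular grading *)

Section Criterion.
Variables (F : fieldType) (A : assocAlg F) (G : finGroupType).
Variables (gr : G -> set A) (theta : G -> G -> F).
Hypothesis reg : is_regular_grading gr theta.

Lemma amul_suml I (r : seq I) (f : I -> A) (b : A) :
  amul (\sum_(i <- r) f i) b = \sum_(i <- r) amul (f i) b.
Proof. by apply: (big_morph (fun a => amul a b)) => [u v|]; rewrite ?linearDl ?linear0l. Qed.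

Lemma amul_sumr I (r : seq I) (f : I -> A) (b : A) :
  amul b (\sum_(i <- r) f i) = \sum_(i <- r) amul b (f i).
Proof. by apply: (big_morph (amul b)) => [u v|]; rewrite ?linearD ?linear0. Qed.

(** For given degrees d, two such W give functions of s : 'S_n, sending s to
    twist W (word s), that are proportional. The freedom is used three times: to
    make W depend on degrees only, to separate signs from a factor that depends
    only on the degrees of the word, and to make the sign of s appear. *)
Definition twisting n (d : 'I_n -> G) (W : 'I_n -> 'I_n -> F) : Prop :=
  (forall i j, W i j != 0) /\
  (forall i j, i != j -> W i j = theta (d i) (d j) * W j i).

Definition word n (s : 'S_n) : seq 'I_n := [seq s i | i <- enum 'I_n].

Lemma word_uniq n (s : 'S_n) : uniq (word s).
Proof. by rewrite map_inj_uniq ?enum_uniq //; exact: perm_inj. Qed.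

Lemma word_perm n (s : 'S_n) : perm_eq (word s) (enum 'I_n).
Proof.
apply: uniq_perm; rewrite ?word_uniq ?enum_uniq // => i.
rewrite mem_enum; apply/mapP; exists ((s^-1)%g i); rewrite ?mem_enum //.
by rewrite permKV.
Qed.

Lemma eval_multilin n (c : multilin F n) (x : nat -> A) :
  eval_poly x (multilin_poly c) =
  \sum_(s : 'S_n) c s *: aprod [seq x i | i : 'I_n <- word s].
Proof.
rewrite /multilin_poly.
have e0 : eval_poly x (0 : freeAlg F) = 0.
  by rewrite /eval_poly msupp0 big_seq_fset0.
elim/big_ind2: _ => [|a f b g fa gb|s _] //.
- by have := eval_polyP x 1 f g; rewrite !scale1r fa gb.
rewrite (@eval_polyE _ _ _ [fset FMonom [seq (s i : nat) | i <- enum 'I_n]]%fset) ?msuppU_le //.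
by rewrite big_seq_fset1 mcoeffU eqxx mulr1n /= -!map_comp.
Qed.

Lemma twist_criterion n (d : 'I_n -> G) (W : 'I_n -> 'I_n -> F) (a : 'I_n -> A)
    (c : multilin F n) : twisting d W -> (forall i, gr (d i) (a i)) ->
  twist W (enum 'I_n) *: \sum_(s : 'S_n) c s *: aprod (map a (word s)) =
  (\sum_(s : 'S_n) c s * twist W (word s)) *: aprod (map a (enum 'I_n)).
Proof.
move=> [W0 Wd] da; rewrite scaler_sumr scaler_suml; apply: eq_bigr => s _.
rewrite scalerA [_ * c s]mulrC -[LHS]scalerA twist_perm ?word_uniq ?word_perm ?scalerA //.
by move=> i j ij; rewrite (Wd _ _ ij) (regular_comm reg (da i) (da j)) scalerA mulrC.
Qed.

(** Evaluation at homogeneous elements whose product is not zero. *)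
Lemma identity_twist n (c : multilin F n) (d : 'I_n -> G) W : (0 < n)%N ->
  is_identity A (multilin_poly c) -> twisting d W ->
  \sum_(s : 'S_n) c s * twist W (word s) = 0.
Proof.
move=> n0 [_ cx] dW; have [a [da a0]] := regular_prod_neq0 reg n0 d.
pose x k := if insub k is Some i then a i else 0.
have xa : forall i : 'I_n, x i = a i by move=> i; rewrite /x valK.
have := twist_criterion c dW da.
have -> : \sum_(s : 'S_n) c s *: aprod (map a (word s)) = 0.
  rewrite -[RHS](cx x) eval_multilin; apply: eq_bigr => s _.
  by rewrite (eq_map xa).
rewrite scaler0 => /esym/eqP; rewrite scaler_eq0 => /orP[/eqP //|/eqP//].
Qed.

(** A multilinear polynomial is linear in each letter, so its letters may be
    split into homogeneous components one at a time. *)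
Lemma twist_identity n (c : multilin F n) : (0 < n)%N ->
  (forall d : 'I_n -> G, exists2 W, twisting d W &
    \sum_(s : 'S_n) c s * twist W (word s) = 0) ->
  is_identity A (multilin_poly c).
Proof.
move=> n0 cW; split.
  rewrite /multilin_poly raddf_sum big1 // => s _ /=.
  rewrite mcoeffU; case: eqP => // /(congr1 (fun m : fmonom nat => size (m : seq nat))) /=.
  by rewrite size_map size_enum_ord => n00; rewrite n00 in n0.
move=> x; rewrite eval_multilin.
pose ev (a : 'I_n -> A) := \sum_(s : 'S_n) c s *: aprod (map a (word s)).
suff H k (a : 'I_n -> A) : (k <= n)%N ->
    (forall i : 'I_n, (k <= i)%N -> exists g, gr g (a i)) -> ev a = 0.
  by apply: (H n) => // i; rewrite leqNgt ltn_ord.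
elim: k a => [|k ih] a kn ak.
  have /fin_all_exists[d da] : forall i, exists g, gr g (a i) by move=> i; exact: ak.
  have [W dW cW0] := cW d; have := twist_criterion c dW da.
  rewrite cW0 scale0r => /eqP; rewrite scaler_eq0 => /orP[|/eqP //].
  by case: dW => W0 _; rewrite (negPf (twist_neq0 W0 _)).
pose j := Ordinal kn.
have [f [[fgr fa] _]] := grading_decomp (regular_grading reg) (a j).
pose upd b i := if i == j then b else a i.
have evD : ev a = \sum_g ev (upd (f g)).
  rewrite exchange_big; apply: eq_bigr => s _; rewrite -scaler_sumr; congr (_ *: _).
  have js : j \in word s by rewrite (perm_mem (word_perm s)) mem_enum.
  move: (word_uniq s); case/splitPr: js => s1 s2.
  rewrite cat_uniq cons_uniq /= negb_or.
  move=> /and4P[_ /andP[j1 _] j2 _].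
  have mapu b r : j \notin r -> map (upd b) r = map a r.
    move=> jr; apply/eq_in_map => i ir; rewrite /upd.
    by case: eqP => // ij; rewrite -ij ir in jr.
  have mapj b : map (upd b) (s1 ++ j :: s2) = map a s1 ++ b :: map a s2.
    by rewrite map_cat map_cons !mapu // /upd eqxx.
  under eq_bigr do rewrite mapj.
  rewrite map_cat map_cons -fa.
  have prodl (t : seq A) : aprod (\sum_g f g :: t) = \sum_g aprod (f g :: t).
    case: t => [//|u t]; rewrite aprod_cons //.
    rewrite amul_suml; apply: eq_bigr => g _; by rewrite [RHS]aprod_cons.
  case: (map a s1) => [|u t]; first exact: prodl.
  rewrite aprod_cat // prodl amul_sumr; apply: eq_bigr => g _.
  by rewrite aprod_cat.
rewrite evD big1 // => g _; apply: ih; first exact: ltnW.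
move=> i ki; rewrite /upd; case: eqP => [_|ij]; first by exists g.
by apply: ak; rewrite ltn_neqAle ki andbT; apply/eqP => ki'; apply: ij; apply: val_inj; rewrite /= ki'.
Qed.

End Criterion.

Section Codimension.
Variables (F : fieldType) (A : assocAlg F) (G : finGroupType).
Variables (gr : G -> set A) (theta : G -> G -> F).
Hypothesis reg : is_regular_grading gr theta.

Lemma dim_multilin n : \dim {:multilin F n} = n`!.
Proof. by rewrite dimvf /dim /= card_Sn muln1. Qed.

Lemma std_twisting n (d : 'I_n -> G) :
  twisting theta d (fun i j => if (i < j)%N then 1 else theta (d i) (d j)).
Proof.
have bi := regular_skew_bicharacter reg.
split=> [i j|i j ij]; first by case: ifP; rewrite ?oner_eq0 ?(skew_neq0 bi).
case: ltngtP => [ij'|ji|/val_inj ij']; rewrite ?mulr1 ?(skew_sym bi) //.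
by rewrite ij' eqxx in ij.
Qed.

(** The multilinear identities are the common kernel of #|G| ^ n linear
    forms, one for each choice of degrees. *)
Lemma codim_le n : (0 < n)%N -> (codim A n <= #|G| ^ n)%N.
Proof.
move=> n0; pose E := {ffun 'I_n -> G}.
pose W (d : 'I_n -> G) (i j : 'I_n) := if (i < j)%N then 1 else theta (d i) (d j).
pose f (c : multilin F n) : 'rV[F]_#|E| :=
  \row_j \sum_(s : 'S_n) c s * twist (W (enum_val j : E)) (word s).
have lf : linear f.
  move=> k c1 c2; apply/rowP => j; rewrite !mxE mulr_sumr -big_split.
  by apply: eq_bigr => s _; rewrite !ffunE mulrDl mulrA.
pose fL : {linear multilin F n -> 'rV[F]_#|E|} :=
  HB.pack f (GRing.isLinear.Build _ _ _ _ f lf).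
have ker c : c \in lker (linfun fL) -> c \in multilin_id A n.
  rewrite memv_ker lfunE => /eqP fc0; apply/multilin_idP.
  apply: (twist_identity reg) => // d.
  exists (W d); first exact: std_twisting.
  have := congr1 (fun M : 'rV_#|E| => M 0 (enum_rank (finfun d))) fc0.
  rewrite !mxE enum_rankK (_ : fun_of_fin (finfun d) = d) //.
  by apply/funext => i; rewrite ffunE.
rewrite /codim leq_subLR.
have := limg_ker_dim (linfun fL) fullv; rewrite capfv => <-.
apply: leq_add; first by apply: dimvS; apply/subvP.
by apply: leq_trans (dimvS (subvf _)) _; rewrite dimvf /dim /= mul1n card_ffun card_ord.
Qed.

(** The columns are linear forms that vanish on the multilinear identities, by
    identity_twist, evaluated at monomials. *)
Lemma codim_ge_rank n k l (E : finType) (w : 'I_k -> 'S_n)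
    (coef : 'I_l -> E -> F) (d : 'I_l -> E -> 'I_n -> G)
    (W : 'I_l -> E -> 'I_n -> 'I_n -> F) : (0 < n)%N ->
  (forall j e, twisting theta (d j e) (W j e)) ->
  (\rank (\matrix_(i < k, j < l)
     (\sum_e coef j e * twist (W j e) (word (w i)))%R) <= codim A n)%N.
Proof.
move=> n0 dW.
pose f j (c : multilin F n) : F :=
  \sum_e coef j e * \sum_(s : 'S_n) c s * twist (W j e) (word s).
pose u i : multilin F n := [ffun s => (s == w i)%:R].
have := @rank_functionals_le _ _ (multilin_id A n) k l u f.
rewrite (_ : (\matrix_(i, j) f j (u i)) = \matrix_(i < k, j < l)
     \sum_e coef j e * twist (W j e) (word (w i))) => [|].
  apply=> [j c v x|j x /multilin_idP xid]; rewrite /f; last first.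
    by rewrite big1 // => e _; rewrite (identity_twist reg n0 xid (dW j e)) mulr0.
  rewrite [c * _]mulr_sumr -big_split; apply: eq_bigr => e _ /=.
  rewrite mulrCA -mulrDr [c * _]mulr_sumr -big_split; congr (_ * _).
  by apply: eq_bigr => s _; rewrite !ffunE mulrDl mulrA.
apply/matrixP => i j; rewrite !mxE; apply: eq_bigr => e _; congr (_ * _).
rewrite (bigD1 (w i)) //= ffunE eqxx mul1r big1 ?addr0 // => s /negPf si.
by rewrite ffunE si mul0r.
Qed.

End Codimension.

(** * Permutations acting on colourings *)

Section Colourings.
Variables (m : nat) (T : finType).
Implicit Types (e : {ffun 'I_m -> T}) (s : {perm 'I_m}).

Definition recolour e s : {ffun 'I_m -> T} := [ffun i => e (s i)].

Definition content e : {ffun T -> 'I_m.+1} :=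
  [ffun t => inord #|[set i | e i == t]|].

Lemma content_recolour e e0 : content e = content e0 ->
  exists s, recolour e0 s = e.
Proof.
move=> ct.
have /tuple_permP[s es] : perm_eq [tuple e i | i < m] [tuple e0 i | i < m].
  apply/allP => t _ /=; rewrite !count_map -!size_filter -!enumT.
  have card_eq (f : {ffun 'I_m -> T}) :
      size [seq i <- enum 'I_m | preim f (pred1 t) i] = #|[set i | f i == t]|.
    rewrite size_filter -sum1_count big_enum_cond -sum1_card.
    by apply: eq_bigl => i; rewrite inE.
  have le (f : {ffun 'I_m -> T}) : (#|[set i | f i == t]| < m.+1)%N.
    by rewrite ltnS -[X in (_ <= X)%N]card_ord max_card.
  have := congr1 (fun c : {ffun T -> 'I_m.+1} => val (c t)) ct.
  by rewrite !ffunE /= !inordK // !card_eq => ->.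
exists s; apply/ffunP => i; rewrite ffunE.
have := congr1 (fun u => tnth u i) (val_inj es).
by rewrite !tnth_mktuple.
Qed.

(** A colouring fixed by s is determined, together with s, by its content and
    one permutation: choose a colouring e0 of each content and write
    e = e0 o r. Since e0 o r o s = e, the content and r o s give back e, then
    r, then s. *)
Lemma card_fixed_colourings :
  (#|[set x : {perm 'I_m} * {ffun 'I_m -> T} | recolour x.2 x.1 == x.2]|
     <= m.+1 ^ #|T| * m`!)%N.
Proof.
pose rep (u : {ffun T -> 'I_m.+1}) := [pick e0 | content e0 == u].
have repP e : exists2 e0, rep (content e) = Some e0 & content e0 = content e.
  by rewrite /rep; case: pickP => [e0 /eqP|/(_ e)]; [exists e0 | rewrite eqxx].
pose good e s := if rep (content e) is Some e0 then recolour e0 s == e else false.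
have goodP e : exists s, good e s.
  rewrite /good; have [e0 -> c0] := repP e.
  by have [s <-] := content_recolour (esym c0); exists s.
pose tr e := xchoose (goodP e).
pose h (x : {perm 'I_m} * {ffun 'I_m -> T}) := (content x.2, (x.1 * tr x.2)%g).
set X := [set x | _].
have hinj : {in X &, injective h}.
  move=> [s e] [s' e']; rewrite !inE /= => /eqP se /eqP se' [ce pe].
  have ee : e = e'.
    have := xchooseP (goodP e); have := xchooseP (goodP e').
    rewrite -/(tr e) -/(tr e') /good ce; have [e0 -> _] := repP e'.
    move=> /eqP t' /eqP t; apply/ffunP => i.
    have := congr1 (fun p : {perm 'I_m} => e0 (p i)) pe; rewrite !permM.
    have ti (f : {ffun 'I_m -> T}) r k : recolour e0 r = f -> e0 (r k) = f k.
      by move=> <-; rewrite ffunE.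
    rewrite (ti _ _ _ t) (ti _ _ _ t').
    have := congr1 (fun f : {ffun 'I_m -> T} => f i) se; rewrite ffunE => ->.
    by have := congr1 (fun f : {ffun 'I_m -> T} => f i) se'; rewrite ffunE => ->.
  by move: pe; rewrite ee => /mulIg ->.
rewrite -(card_in_imset hinj); apply: leq_trans (max_card _) _.
by rewrite card_prod card_ffun card_ord card_Sn.
Qed.

End Colourings.

Section SignMatrix.
Variables (m : nat) (T : finType).
Let S : finType := {perm 'I_m}.
Let E : finType := {ffun 'I_m -> T}.
Variable B : S -> E * E -> int.
Hypothesis absB : forall s e, `|B s e| = (recolour e.1 s == e.2)%:R.

Let mult (s t : S) : nat := #|[set d : E | recolour d s == recolour d t]|.

Lemma recolour_inj (s : S) : injective (fun d : E => recolour d s).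
Proof.
move=> d d' dd; apply/ffunP => i.
have := congr1 (fun f : E => f ((s^-1)%g i)) dd.
by rewrite !ffunE permKV.
Qed.

Lemma multM (s t r : S) : mult (r * s)%g (r * t)%g = mult s t.
Proof.
have rec d u : recolour d (r * u)%g = recolour (recolour d u) r.
  by apply/ffunP => i; rewrite !ffunE permM.
by apply: eq_card => d; rewrite !inE !rec (inj_eq (@recolour_inj r)).
Qed.

Lemma multC (s t : S) : mult s t = mult t s.
Proof. by apply: eq_card => d; rewrite !inE eq_sym. Qed.

(** A pair of colourings fixed by s is a colouring by T * T fixed by s. *)
Lemma sum_sqr_mult : (\sum_s mult s 1%g ^ 2 <= m.+1 ^ (#|T| ^ 2) * m`!)%N.
Proof.
have := @card_fixed_colourings m (T * T)%type.
rewrite card_prod mulnn; apply: leq_trans.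
rewrite -sum1_card (eq_bigl (fun x : S * {ffun 'I_m -> T * T} => recolour x.2 x.1 == x.2)); last first.
  by move=> x; rewrite inE.
rewrite -(pair_big_dep xpredT (fun s (e : {ffun 'I_m -> T * T}) => recolour e s == e) (fun _ _ => 1%N)).
apply: leq_sum => s _; rewrite sum1_card -mulnn /mult -cardsX.
pose h (x : E * E) : {ffun 'I_m -> T * T} := [ffun i => (x.1 i, x.2 i)].
have hinj : injective h.
  move=> [a b] [a' b'] /ffunP ab; congr (_, _); apply/ffunP => i;
  by have := ab i; rewrite !ffunE => -[].
rewrite -(card_imset _ hinj); apply: subset_leq_card; apply/fintype.subsetP => _ /imsetP[[a b] + ->].
rewrite !inE => /andP[/eqP /ffunP ea /eqP /ffunP eb]; suff: recolour (h (a, b)) s == h (a, b) by [].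
apply/eqP/ffunP => i.
by rewrite !ffunE; have := ea i; have := eb i; rewrite !ffunE !perm1 /= => -> ->.
Qed.

Let M : 'M[rat]_(#|S|, #|{: E * E}|) :=
  map_mx intr (\matrix_(i, j) B (enum_val i) (enum_val j)).

(** Cauchy-Schwarz for the Gram matrix K of the rows. Its trace is m! #|T|^m.
    Whatever the signs of B are, the entry of K at (s, t) is at most the number
    mult s t of colourings on which s and t agree, so that the trace of K K^T is
    at most m! times the sum bounded in sum_sqr_mult. *)
Lemma sign_matrix_rank :
  (#|T| ^ (2 * m) <= \rank M * m.+1 ^ (#|T| ^ 2))%N.
Proof.
pose K := M *m M^T.
have KE i j : K i j = \sum_e (B (enum_val i) e * B (enum_val j) e)%:~R.
  rewrite mxE (big_enum_val (fun e => (B (enum_val i) e * B (enum_val j) e)%:~R)) /=.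
  by apply: eq_bigr => k _; rewrite !mxE intrM.
have sumB s t : \sum_e `|B s e| * `|B t e| = (mult s t)%:R :> int.
  rewrite /mult -sum1_card natr_sum [RHS]big_mkcond /=.
  rewrite (eq_bigr (fun e : E * E => (fun d c => `|B s (d, c)| * `|B t (d, c)|) e.1 e.2)); last by case.
  rewrite -(pair_bigA _ (fun d c => `|B s (d, c)| * `|B t (d, c)|)) /=.
  apply: eq_bigr => d _; rewrite inE (bigD1 (recolour d s)) //= big1 => [|c cs].
    by rewrite !absB /= eqxx mul1r addr0 eq_sym; case: eqP.
  by rewrite !absB /= [_ == c]eq_sym (negPf cs) mul0r.
have trK : \tr K = (m`! * #|T| ^ m)%:R.
  rewrite /mxtrace (eq_bigr (fun=> (#|T| ^ m)%:R)) => [|i _].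
    by rewrite sumr_const card_ord /= card_Sn -mulrnA mulnC.
  rewrite KE -rmorph_sum /= -[RHS](rmorph_nat (intr : int -> rat)); congr (_%:~R).
  have := sumB (enum_val i) (enum_val i).
  rewrite (_ : mult _ _ = (#|T| ^ m)%N); last first.
    rewrite /mult (_ : [set d | _]%SET = [set: E]%SET).
      by rewrite cardsT card_ffun card_ord.
    by apply/setP => d; rewrite !inE eqxx.
  move=> <-; apply: eq_bigr => e _.
  by rewrite -normrM -expr2 ger0_norm ?sqr_ge0.
have trKK : \tr (K *m K^T) <= (m`! * (m.+1 ^ (#|T| ^ 2) * m`!))%:R.
  rewrite /mxtrace.
  have Kle i j : `|K i j| <= (mult (enum_val i) (enum_val j))%:R.
    rewrite KE -rmorph_sum /= -intr_norm -[leRHS](rmorph_nat (intr : int -> rat)) ler_int.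
    by rewrite -sumB (le_trans (ler_norm_sum _ _ _)) // ler_sum // => e _; rewrite normrM.
  have rowle i : (K *m K^T) i i <= (m.+1 ^ (#|T| ^ 2) * m`!)%:R.
    pose s := (enum_val i : S).
    rewrite mxE; apply: le_trans (_ : (\sum_t mult s t ^ 2)%:R <= _); last first.
      rewrite ler_nat (reindex_inj (mulgI s)) /=.
      under eq_bigr => t _ do rewrite -{1}(mulg1 s) multM multC.
      exact: sum_sqr_mult.
    rewrite natr_sum (big_enum_val (fun t => (mult s t ^ 2)%:R)) /=.
    apply: ler_sum => j _; rewrite [K^T _ _]mxE -expr2 natrX -[leLHS]ger0_norm ?sqr_ge0 //.
    by rewrite normrX lerXn2r ?nnegrE ?ler0n.
  apply: le_trans (ler_sum _ (fun i _ => rowle i)) _.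
  by rewrite sumr_const card_ord card_Sn -mulrnA mulnC.
have := sqr_mxtrace_le_rank K; rewrite trK => h.
have {}h := le_trans h (ler_wpM2l (ler0n _ _) trKK).
move: h; rewrite -natrX -natrM ler_nat => h.
rewrite -(@leq_pmul2l (m`! * m`!)) ?muln_gt0 ?fact_gt0 //.
apply: leq_trans (_ : \rank K * (m`! * (m.+1 ^ #|T| ^ 2 * m`!)) <= _)%N.
  by apply: leq_trans h; rewrite expnMn -(mulnn m`!) -expnM (mulnC m 2).
have rk : (\rank K <= \rank M)%N by rewrite mxrankM_maxl.
apply: leq_trans (leq_mul rk (leqnn _)) _.
by rewrite eq_leq //; lia.
Qed.

End SignMatrix.

(** * Separating permutations by interleaved letters *)

Section Interleaving.
Variables (F : fieldType) (G : finGroupType) (theta : G -> G -> F).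
Hypotheses (bi : skew_bicharacter theta) (mini : is_minimal theta).
Variables (n m : nat) (y : 'I_m -> 'I_n) (v : 'I_n -> option 'I_m).
Hypotheses (yK : pcancel y v) (vK : ocancel v y).
Hypothesis y_next : forall i, exists2 q : 'I_n, q = (y i).+1 :> nat & v q = None.

(** The letters y i are permuted by s, and the remaining ones, which are those
    on which v is undefined, stay in place. *)
Definition extend_fun (s : {perm 'I_m}) (p : 'I_n) : 'I_n :=
  if v p is Some i then y (s i) else p.

Lemma extend_fun_inj s : injective (extend_fun s).
Proof.
move=> p q; rewrite /extend_fun.
have := vK p; have := vK q; case vp: (v p) => [i|]; case vq: (v q) => [j|] //=.
- by move=> <- <- /(pcan_inj yK)/perm_inj ->.
- by move=> _ _ e; move: vq; rewrite -e yK.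
- by move=> _ _ e; move: vp; rewrite e yK.
Qed.

Definition extend s : 'S_n := perm (@extend_fun_inj s).

Lemma v_extend s p : v (extend s p) = omap s (v p).
Proof. by rewrite permE /extend_fun; case vp: (v p) => [i|] //=; rewrite yK. Qed.

Lemma extend_None s p : v p = None -> extend s p = p.
Proof. by rewrite permE /extend_fun => ->. Qed.

Implicit Types (d c : {ffun 'I_m -> G}) (e : {ffun 'I_n -> G}).

Definition degree d e p : G := if v p is Some i then d i else e p.

(** The choice of weights. On two letters y the weight is a function of their
    degrees times a sign; between a y and a remaining letter the scalar is paid
    only when y comes first; two remaining letters in their original order cost
    nothing. *)
Definition order_weight (g h : G) : F :=
  if (enum_rank h < enum_rank g)%N then theta g h else 1.

Definition sign_weight d (i j : 'I_m) : int :=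
  if [&& d i == d j, (j < i)%N & theta (d i) (d i) != 1] then -1 else 1.

Definition weight d e (p q : 'I_n) : F :=
  match v p, v q with
  | Some i, Some j => order_weight (d i) (d j) * (sign_weight d i j)%:~R
  | Some i, None => theta (d i) (e q)
  | None, Some _ => 1
  | None, None => if (p < q)%N then 1 else theta (e p) (e q)
  end.

Lemma order_weight_neq0 g h : order_weight g h != 0.
Proof. by rewrite /order_weight; case: ifP; rewrite ?oner_eq0 ?skew_neq0. Qed.

Lemma weight_twisting d e : twisting theta (degree d e) (weight d e).
Proof.
have sym := skew_sym bi; have t0 := skew_neq0 bi.
have s0 i j : (sign_weight d i j)%:~R != 0 :> F.
  by rewrite /sign_weight; case: ifP => _; rewrite ?oppr_eq0 oner_eq0.
have signE g : (if theta g g != 1 then -1 else 1 : int)%:~R = theta g g :> F.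
  have [->|->] := skew_diag bi g; first by rewrite eqxx.
  by case: eqP => [->|].
split=> [p q|p q pq]; rewrite /weight /degree.
  case: (v p) => [i|]; case: (v q) => [j|] //; rewrite ?oner_eq0 //.
    by rewrite mulf_neq0 ?order_weight_neq0.
  by case: ifP; rewrite ?oner_eq0.
have := vK p; have := vK q; case vp: (v p) => [i|]; case vq: (v q) => [j|] /= jq ip.
- rewrite /order_weight /sign_weight [d j == _]eq_sym.
  have [dij|dij] := eqVneq (d i) (d j).
    rewrite dij ltnn /= !mul1r.
    have ij : i != j by apply: contra_neq pq => ij; rewrite -jq -ip ij.
    case: ltngtP => [ij'|ji|/val_inj ij'] /=; last by rewrite ij' eqxx in ij.
      by rewrite signE mulr1.
    by rewrite signE sym.
  rewrite /= !mulr1; case: ltngtP => [_|_|/val_inj/enum_rank_inj e']; rewrite ?mulr1 ?sym //.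
  by rewrite e' eqxx in dij.
- by rewrite mulr1.
- by rewrite sym.
case: ltngtP => [_|_|/val_inj e']; rewrite ?mulr1 ?sym //.
by rewrite e' eqxx in pq.
Qed.

Definition column_sign d s : int :=
  \prod_(p < n) \prod_(q < n | (p < q)%N)
    if (v p, v q) is (Some i, Some j) then sign_weight d (s i) (s j) else 1.

Definition column_scale c : F :=
  \prod_(p < n) \prod_(q < n | (p < q)%N)
    if (v p, v q) is (Some i, Some j) then order_weight (c i) (c j) else 1.

(** The inverse of the product of the weights of a letter y and a remaining
    letter, for a word in which the letters y occur with the degrees c; it is
    the conjugate character used to test for c. *)
Definition detector c e : F :=
  \prod_(p < n) \prod_(q < n | (p < q)%N)
    if (v p, v q) is (Some i, None) then (theta (c i) (e q))^-1 else 1.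

Lemma column_scale_neq0 c : column_scale c != 0.
Proof.
apply/prodf_neq0 => p _; apply/prodf_neq0 => q _.
by case: (v p) => [i|]; case: (v q) => [j|]; rewrite ?oner_eq0 ?order_weight_neq0.
Qed.

(** Only column_sign depends on s otherwise than through the degrees
    recolour d s of the letters y in the order in which they occur. *)
Lemma twist_extend d e s :
  twist (weight d e) (word (extend s)) =
  (column_sign d s)%:~R * column_scale (recolour d s) *
  (detector (recolour d s) e)^-1.
Proof.
rewrite /word twist_prod /column_sign /column_scale /detector.
rewrite rmorph_prod -prodfV -!big_split; apply: eq_bigr => p _ /=.
rewrite rmorph_prod -prodfV -!big_split; apply: eq_bigr => q pq /=.
rewrite /weight !v_extend; case vp: (v p) => [i|]; case vq: (v q) => [j|] /=;
  rewrite ?invrK ?invr1 ?mulr1 ?mul1r //.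
- by rewrite !ffunE mulrC.
- by rewrite !ffunE extend_None.
by rewrite !extend_None // pq.
Qed.

(** Take the first y i at which d and c differ. In the position q after it
    the product of the mixed factors is the nontrivial character of
    (c i)^-1 * d i, evaluated at e q; its sum over e q vanishes. *)
Lemma sum_detector c d :
  \sum_e detector c e * (detector d e)^-1 = (#|G| ^ n)%:R * (d == c)%:R.
Proof.
pose f (q : 'I_n) (g : G) : F := \prod_(p < n | (p < q)%N)
  if (v p, v q) is (Some i, None) then theta ((c i)^-1 * d i)%g g else 1.
transitivity (\prod_(q < n) \sum_g f q g).
  rewrite bigA_distr_bigA; apply: eq_bigr => e _.
  rewrite /detector -prodfV -big_split /= /f.
  under eq_bigr => p _ do rewrite -prodfV -big_split /=.
  rewrite (exchange_big_dep xpredT) //=; apply: eq_bigr => q _.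
  apply: eq_bigr => p _; case: (v p) => [i|]; case: (v q) => [j|]; rewrite ?invr1 ?mulr1 //.
  by rewrite invrK skewMl // skewVl.
have [dc|dc] := eqVneq d c.
  rewrite mulr1 natrX -[in RHS](card_ord n) -prodr_const; apply: eq_bigr => q _.
  rewrite (eq_bigr (fun=> 1)) ?sumr_const // => g _.
  apply: big1 => p _; rewrite dc; case: (v p) => [i|]; case: (v q) => [j|] //.
  by rewrite mulVg skew1l.
have [i0 i0P] : exists i, d i != c i.
  apply/existsP; apply: contra_neqT dc; rewrite negb_exists => /forallP h.
  by apply/ffunP => i; apply/eqP; rewrite -[_ == _]negbK.
case: (@arg_minnP _ i0 (fun i => d i != c i) (fun i => y i : nat) i0P) => i dci imin.
have [q qi vq] := y_next i.
rewrite mulr0 (bigD1 q) //= (eq_bigr (theta ((c i)^-1 * d i)%g)) => [|g _].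
  rewrite sum_skew // -eq_mulVg1 eq_sym (negPf dci) mulr0 mul0r //.
rewrite /f (bigD1 (y i)) ?qi //= yK vq big1 ?mulr1 // => p.
rewrite ltnS => /andP[py pyi]; case vp: (v p) => [j|] //.
have pj : p = y j by have := vK p; rewrite vp.
suff -> : d j = c j by rewrite mulVg skew1l.
apply/eqP; rewrite -[_ == _]negbK; apply/negP => /imin; rewrite -pj leqNgt.
by rewrite ltn_neqAle py andbT pyi.
Qed.

End Interleaving.

Lemma normr_column_sign (F : fieldType) (G : finGroupType) (theta : G -> G -> F)
    n m (v : 'I_n -> option 'I_m) d s : `|column_sign theta v d s| = 1.
Proof.
have norm1 (b : bool) : `|if b then -1 else 1 : int| = 1 by case: b.
rewrite /column_sign normr_prod big1 // => p _; rewrite normr_prod big1 // => q _.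
by case: (v p) => [i|]; case: (v q) => [j|]; rewrite ?normr1 ?norm1.
Qed.

(** The words x_0 y_0 x_1 y_1 ..., with the letters y permuted, realize the
    matrix of sign_matrix_rank as a matrix of linear forms on multilinear
    polynomials modulo identities. *)
Lemma codim_ge (F : fieldType) (A : assocAlg F) (G : finGroupType)
    (gr : G -> set A) (theta : G -> G -> F) n m :
  [pchar F] =i pred0 -> is_regular_grading gr theta -> is_minimal theta ->
  (m.*2 < n)%N ->
  (#|G| ^ (2 * m) <= codim A n * m.+1 ^ (#|G| ^ 2))%N.
Proof.
move=> F0 reg mini mn; have bi := regular_skew_bicharacter reg.
have n0 : (0 < n)%N by apply: leq_ltn_trans mn.
have yn (i : 'I_m) : (i.*2.+1 < n)%N by have := ltn_ord i; lia.
pose y i := Ordinal (yn i).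
pose v (p : 'I_n) : option 'I_m := if odd p then insub p./2 else None.
have yK : pcancel y v.
  move=> i; rewrite /v /= odd_double /= uphalf_double; exact: valK.
have vK : ocancel v y.
  move=> p; rewrite /v; case: ifP => // op; case: insubP => //= i _ ip.
  by apply: val_inj; rewrite /= ip; have := odd_double_half p; rewrite op.
have y_next i : exists2 q : 'I_n, q = (y i).+1 :> nat & v q = None.
  have qn : (i.*2.+2 < n)%N by have := ltn_ord i; lia.
  by exists (Ordinal qn) => //; rewrite /v /= negbK odd_double.
pose B (s : {perm 'I_m}) (x : {ffun 'I_m -> G} * {ffun 'I_m -> G}) : int :=
  (recolour x.1 s == x.2)%:R * column_sign theta v x.1 s.
have absB s x : `|B s x| = (recolour x.1 s == x.2)%:R.
  by rewrite normrM normr_column_sign mulr1 normr_nat.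
apply: leq_trans (sign_matrix_rank absB) _; rewrite leq_mul2r; apply/orP; right.
apply: leq_trans (rank_int_le _ F0) _.
have G0 : (#|G| ^ n)%:R != 0 :> F.
  by rewrite pcharf0_natr // -lt0n expn_gt0 -cardsT cardG_gt0.
(* detector c e selects the columns with recolour d s = c, by sum_detector;
   the first factor normalizes the entries to +-1. *)
pose coef (j : 'I_#|{: {ffun 'I_m -> G} * {ffun 'I_m -> G}}|)
    (e : {ffun 'I_n -> G}) : F :=
  (column_scale theta v (enum_val j).2 * (#|G| ^ n)%:R)^-1 *
  detector theta v (enum_val j).2 e.
have := codim_ge_rank reg (fun i : 'I_#|{perm 'I_m}| => extend yK vK (enum_val i))
  coef (d := fun j e => degree v (enum_val j).1 e)
  (W := fun j e => weight theta v (enum_val j).1 e) n0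
  (fun j e => weight_twisting bi vK _ _).
apply: leq_trans; rewrite eq_leq //; congr (\rank _).
apply/matrixP => i j; rewrite !mxE /B /coef.
move: (enum_val i) (enum_val j) => s [d c] /=.
under eq_bigr => e _ do rewrite twist_extend mulrACA -mulrA.
rewrite -!mulr_sumr (sum_detector bi mini yK vK y_next).
rewrite rmorphM /= rmorph_nat; have [->|_] := eqVneq; last by rewrite !mulr0 mul0r.
rewrite mul1r mulr1 invfM; move: (column_scale_neq0 bi v c) => c0; field.
by rewrite G0.
Qed.

(** * Growth of the codimensions *)

Local Open Scope classical_set_scope.

Lemma ln_le_sqrt (R : realType) (x : R) : 0 < x -> ln x <= 2 * Num.sqrt x.
Proof.
move=> x0; have s0 : 0 < Num.sqrt x by rewrite sqrtr_gt0.
rewrite -{1}(sqr_sqrtr (ltW x0)) lnXn // -[ln _ *+ 2]mulr_natl ler_pM2l //.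
exact/ltW/ln_sublinear.
Qed.

(** A polynomial factor disappears in the n-th root: after taking logarithms
    it contributes at most a constant times sqrt n / n. *)
Lemma root_cvg (R : realType) (u : nat -> nat) (a C K : nat) :
  (0 < a)%N -> (0 < C)%N ->
  (forall n, (0 < n)%N -> (u n <= a ^ n)%N) ->
  (forall n, (0 < n)%N -> (a ^ n <= C * u n * n ^ K)%N) ->
  (fun n => ((u n)%:R : R) `^ (n%:R^-1)) @ \oo --> (a%:R : R).
Proof.
move=> a0 C0 ule uge; rewrite -cvg_shiftS.
have u0 n : (0 < u n.+1)%N.
  have := leq_trans (_ : 0 < a ^ n.+1)%N (uge n.+1 isT).
  by rewrite expn_gt0 a0 !muln_gt0 => /(_ isT) /andP[/andP[]].
have a0' : 0 < (a%:R : R) by rewrite ltr0n.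
have u0' n : 0 < ((u n.+1)%:R : R) by rewrite ltr0n.
rewrite (_ : (fun n => _) = (fun n => expR (ln (u n.+1)%:R / n.+1%:R))); last first.
  by apply/funext => n; rewrite /powR gt_eqF //= mulrC.
rewrite -[a%:R]lnK ?posrE //; apply: continuous_cvg; first exact: continuous_expR.
pose D : R := ln C%:R + 2 * K%:R.
apply: (@squeeze_cvgr _ _ _ _ (fun n => ln a%:R - D * Num.sqrt (harmonic n)) (fun=> ln a%:R)).
- near=> n; apply/andP; split; last first.
    rewrite ler_pdivrMr ?ltr0n // mulr_natr -lnXn // ler_ln ?posrE ?exprn_gt0 //.
    by rewrite -natrX ler_nat ule.
  have n0 : 0 < (n.+1%:R : R) by rewrite ltr0n.
  have s0 : 0 < Num.sqrt (n.+1%:R : R) by rewrite sqrtr_gt0.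
  have C1 : 0 <= ln (C%:R : R) by rewrite ln_ge0 // ler1n.
  rewrite ler_pdivlMr // mulrBl lerBlDr.
  have h : ln (a%:R : R) * n.+1%:R <= ln C%:R + ln (u n.+1)%:R + K%:R * ln n.+1%:R.
    rewrite mulr_natr -lnXn // mulr_natl -lnXn // -!lnM ?posrE ?mulr_gt0 ?exprn_gt0 ?ltr0n //.
    rewrite ler_ln ?posrE ?mulr_gt0 ?exprn_gt0 ?ltr0n // -!natrX -!natrM ler_nat.
    exact: uge.
  apply: le_trans h _; rewrite [_ + ln (u _)%:R]addrC -addrA lerD2l.
  have -> : D * Num.sqrt (harmonic n) * n.+1%:R = D * Num.sqrt n.+1%:R.
    rewrite -mulrA; congr (_ * _); rewrite /= sqrtrV ?ler0n //.
    by rewrite -{2}(sqr_sqrtr (ltW n0)) expr2 mulKf // gt_eqF.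
  rewrite /D mulrDl lerD //.
    rewrite -[leLHS]mulr1 ler_wpM2l // -[leLHS]sqrtr1 ler_sqrt // ler1n //.
  by rewrite -mulrA mulrCA ler_wpM2l // ln_le_sqrt.
- rewrite -[X in _ --> X]subr0; apply: cvgB; first exact: cvg_cst.
  rewrite -[X in _ --> X](mulr0 D); apply: cvgM; first exact: cvg_cst.
  rewrite -[X in _ --> X](@sqrtr0 R).
  by apply: continuous_cvg; [exact: sqrt_continuous | exact: cvg_harmonic].
- exact: cvg_cst.
Unshelve. all: by end_near. Qed.

Section Growth.
Variables (F : fieldType) (A : assocAlg F) (G : finGroupType).
Variables (gr : G -> set A) (theta : G -> G -> F).
Hypotheses (F0 : [pchar F] =i pred0) (reg : is_regular_grading gr theta).

Lemma exp_lt_fact (N : nat) : exists2 n, (0 < n)%N & (N ^ n < n`!)%N.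
Proof.
have [->|N0] := posnP N; first by exists 1.
(* n! >= (2 N)^(n - 2 N), and 2^(n - 2 N) > N^(2 N) for n = 2 N + j. *)
pose j := (N ^ (2 * N))%N.
have factge k : ((2 * N) ^ k <= (2 * N + k)`!)%N.
  elim: k => [|k ih]; first by rewrite fact_gt0.
  by rewrite addnS factS expnS leq_mul //; lia.
exists (2 * N + j)%N; first by lia.
apply: leq_trans (factge j); rewrite expnD expnMn ltn_pmul2r ?expn_gt0 ?N0 //.
exact: ltn_expl.
Qed.

Lemma multilin_poly_eq0 n (c : multilin F n) : multilin_poly c = 0 -> c = 0.
Proof.
move=> c0; apply/ffunP => s; rewrite ffunE.
have := congr1 (mcoeff (FMonom [seq (s i : nat) | i <- enum 'I_n])) c0.
rewrite mcoeff0 /multilin_poly raddf_sum (bigD1 s) //= mcoeffU eqxx mulr1n.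
rewrite big1 ?addr0 // => t ts; rewrite mcoeffU; case: eqP => // /(congr1 (fun u : fmonom nat => u : seq nat)) /= ets.
case/eqP: ts; apply/permP => i; apply: val_inj => /=.
have := congr1 (fun u => nth 0%N u i) ets.
by rewrite !(nth_map i) -?enumT ?size_enum_ord // nth_ord_enum => ->.
Qed.

Lemma regular_PI : is_PI A.
Proof.
have [n n0 lt] := exp_lt_fact #|G|.
have := codim_le reg n0; rewrite /codim dim_multilin leq_subLR => h.
have idn0 : multilin_id A n != 0%VS.
  rewrite -dimv_eq0 -lt0n; lia.
exists (multilin_poly (vpick (multilin_id A n))); split.
  by apply: contra_neq idn0 => /multilin_poly_eq0/eqP; rewrite vpick0 => /eqP.
by apply/multilin_idP; exact: memv_pick.
Qed.

Lemma codim_root_cvg (R : realType) : is_minimal theta ->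
  codim_root A R @ \oo --> (#|G|%:R : R).
Proof.
move=> mini; have G0 : (0 < #|G|)%N by rewrite -cardsT cardG_gt0.
apply: (@root_cvg R (codim A) #|G| (#|G| ^ 2) (#|G| ^ 2)) => //.
- by rewrite expn_gt0 G0.
- by move=> n n0; exact: (codim_le reg n0).
move=> n n0; have [m mn nm] : exists2 m, (m.*2 < n)%N & (n <= m.*2.+2)%N.
  by exists n.-1./2; have := odd_double_half n.-1; lia.
apply: leq_trans (_ : #|G| ^ (2 + 2 * m) <= _)%N.
  by rewrite leq_pexp2l //; lia.
rewrite expnD -mulnA leq_mul2l; apply/orP; right.
apply: leq_trans (codim_ge F0 reg mini mn) _.
by apply: leq_mul => //; rewrite leq_exp2r ?expn_gt0 ?G0 //; lia.
Qed.

End Growth.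

(** * Standard polynomials *)

Definition standard (F : fieldType) n : multilin F n := [ffun s : 'S_n => (-1) ^+ s].

Section Standard.
Variables (F : fieldType) (A : assocAlg F) (G : finGroupType).
Variables (gr : G -> set A) (theta : G -> G -> F).
Hypotheses (F0 : [pchar F] =i pred0) (reg : is_regular_grading gr theta).

(** Among more than #|G| homogeneous elements two have the same degree; they
    commute, so the alternating sum cancels. *)
Lemma standard_identity n : (forall g, theta g g = 1) -> (#|G| < n)%N ->
  is_identity A (multilin_poly (standard F n)).
Proof.
move=> t1 Gn; have bi := regular_skew_bicharacter reg.
apply: (twist_identity reg); first exact: leq_trans Gn.
move=> d; have [i [j [ij dij]]] : exists i, exists j, i != j /\ d i = d j.
  have : ~~ injectiveb (finfun d).
    apply/injectiveP => /leq_card; rewrite card_ord leqNgt Gn //.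
  move=> /injectivePn[i [j ij]]; rewrite !ffunE => dij; by exists i, j.
pose W p q := order_weight theta (d p) (d q).
exists W.
  split=> [p q|p q pq]; first exact: order_weight_neq0.
  rewrite /W /order_weight; case: ltngtP => [_|_|/val_inj/enum_rank_inj ->].
  - by rewrite mulr1.
  - by rewrite skew_sym.
  by rewrite t1 mulr1.
set S := \sum_s _; suff : S = - S.
  move/eqP; rewrite -addr_eq0 -mulr2n -mulr_natr mulf_eq0 pcharf0_natr // orbF.
  by move/eqP.
rewrite {1}/S (reindex_inj (mulIg (tperm i j))) -sumrN; apply: eq_bigr => s _.
rewrite !ffunE odd_permM odd_tperm ij signr_addb /= expr1 mulrN1 mulNr.
congr (- (_ * _)); rewrite /word !twist_prod; apply: eq_bigr => p _.
have dt x : d (tperm i j x) = d x by case: tpermP => // ->.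
by apply: eq_bigr => q _; rewrite /W !permM !dt.
Qed.

(** If theta g g = -1, elements of degree g anticommute: the signs cancel and
    the standard polynomial takes the value n! a_1 ... a_n. The antisymmetric
    weights j - i produce the sign of a permutation, as the effect of permuting
    the columns of a Vandermonde determinant. *)
Lemma standard_not_identity n g : (0 < n)%N -> theta g g = -1 ->
  ~ is_identity A (multilin_poly (standard F n)).
Proof.
move=> n0 tg idn.
pose a : 'rV[F]_n := \row_j (j : nat)%:R.
have aI i j : i != j -> a 0 j - a 0 i != 0.
  move=> ij; rewrite !mxE; have [lt|gt|/val_inj e] := ltngtP i j.
  - by rewrite -natrB 1?ltnW // pcharf0_natr // subn_eq0 -ltnNge.
  - by rewrite -oppr_eq0 opprB -natrB 1?ltnW // pcharf0_natr // subn_eq0 -ltnNge.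
  by rewrite e eqxx in ij.
pose W (i j : 'I_n) := if i == j then 1 else a 0 j - a 0 i.
have dW : twisting theta (fun=> g) W.
  split=> [i j|i j ij]; rewrite /W; first by case: ifPn; rewrite ?oner_eq0 // => /aI.
  by rewrite [j == i]eq_sym (negPf ij) tg mulN1r opprB.
have := identity_twist reg n0 idn dW.
rewrite (eq_bigr (fun=> \det (Vandermonde n a))) => [|s _].
  rewrite sumr_const card_Sn => /eqP; rewrite -mulr_natr mulf_eq0.
  rewrite pcharf0_natr // (gtn_eqF (fact_gt0 n)) orbF det_Vandermonde.
  apply/negP; rewrite prodf_seq_neq0.
  apply/allP => i _ /=; rewrite prodf_seq_neq0; apply/allP => j _ /=.
  apply/implyP => ij; apply: aI; apply: contraTneq ij => ->; by rewrite ltnn.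
have -> : twist W (word s) = \det (Vandermonde n (col_perm s a)).
  rewrite det_Vandermonde /word twist_prod; apply: eq_bigr => p _.
  apply: eq_bigr => q pq; rewrite /W (inj_eq perm_inj) !mxE.
  by rewrite -val_eqE /= (ltn_eqF pq).
have -> : Vandermonde n (col_perm s a) = col_perm s (Vandermonde n a).
  by apply/matrixP => i j; rewrite !mxE.
by rewrite col_permE det_mulmx det_perm odd_permV ffunE mulrCA -signr_addb addbb mulr1.
Qed.

End Standard.

(** Being an identity depends on A only, so the triviality of the sign
    character is the same for all regular gradings of A by groups of a given
    order. *)
Lemma standard_diag (F : fieldType) (A : assocAlg F) (G : finGroupType)
    (gr : G -> set A) (theta : G -> G -> F) n :
  [pchar F] =i pred0 -> is_regular_grading gr theta -> (#|G| < n)%N ->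
  [forall g, theta g g == 1] <-> is_identity A (multilin_poly (standard F n)).
Proof.
move=> F0 reg Gn; split=> [/forallP t1|idn].
  by apply: (standard_identity F0 reg) => // g; exact/eqP.
apply/forallP => g; apply/eqP.
have [//|tg] := skew_diag (regular_skew_bicharacter reg) g.
by case: (standard_not_identity F0 reg (leq_trans _ Gn) tg idn).
Qed.

Theorem theorem7 (R : realType) (F : closedFieldType)
    (charF0 : [pchar F] =i pred0) (A : assocAlg F) (G H : finGroupType)
    (abG : abelian [set: G]%SET) (abH : abelian [set: H]%SET)
    (grG : G -> set A) (thetaG : G -> G -> F)
    (grH : H -> set A) (thetaH : H -> H -> F)
    (regG : is_regular_grading grG thetaG) (minG : is_minimal thetaG)
    (regH : is_regular_grading grH thetaH) (minH : is_minimal thetaH) :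
  [/\ [/\ #|G| = #|H|, is_PI A, cvgn (codim_root A R)
        & PI_exp A R = #|G|%:R],
      (forall n (eG : 'I_n -> G) (eH : 'I_n -> H),
        bijective eG -> bijective eH ->
        [/\ commutation_mx thetaG eG ~_{in unitmx} commutation_mx thetaH eH,
            \tr (commutation_mx thetaG eG) = \tr (commutation_mx thetaH eH)
          & \det (commutation_mx thetaG eG) = \det (commutation_mx thetaH eH)])
    & (forall n (eG : 'I_n -> G), bijective eG ->
        forall r : F, r ^+ 2 = #|G|%:R ->
        \det (commutation_mx thetaG eG) = r ^+ #|G| \/
        \det (commutation_mx thetaG eG) = - r ^+ #|G|)].
Proof.
have cvG := codim_root_cvg charF0 regG (R := R) minG.
have cvH := codim_root_cvg charF0 regH (R := R) minH.
have GH : #|G| = #|H|.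
  by apply/eqP; rewrite -(eqr_nat R) -(cvg_lim _ cvG) // -(cvg_lim _ cvH).
have biG := regular_skew_bicharacter regG.
have biH := regular_skew_bicharacter regH.
have G0 : (0 < #|G|)%N by rewrite -cardsT cardG_gt0.
have diagGH : [forall g, thetaG g g == 1] = [forall h, thetaH h h == 1].
  have idG := standard_diag charF0 regG (ltnSn #|G|).
  have idH := standard_diag charF0 regH (eq_leq (congr1 succn (esym GH))).
  by apply/idP/idP => [/idG/idH|/idH/idG].
split.
- split=> //; first exact: regular_PI regG.
  + by apply/cvg_ex; exists (#|G|%:R).
  exact: cvg_lim cvG.
- move=> n eG eH bG bH.
  have trE : \tr (commutation_mx thetaG eG) = \tr (commutation_mx thetaH eH).
    by rewrite (tr_commutation_mx biG bG) (tr_commutation_mx biH bH) diagGH GH.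
  have sim : commutation_mx thetaG eG ~_{in unitmx} commutation_mx thetaH eH.
    apply: (@sqr_scalar_simmx F n #|G|%:R) => //.
    + by rewrite pcharf0_natr // -lt0n.
    + exact: sqr_commutation_mx.
    by rewrite GH; exact: sqr_commutation_mx.
  split=> //; have [P Pu /(simmxP Pu) PE] := sim.
  have := congr1 determinant PE; rewrite !det_mulmx mulrC.
  by apply: mulIf; move: Pu; rewrite unitmxE unitfE.
move=> n eG bG r r2.
have nG : n = #|G| by rewrite -[LHS]card_ord; exact: bij_eq_card bG.
have := congr1 determinant (sqr_commutation_mx biG minG bG).
rewrite det_mulmx det_scalar -r2 -expr2 exprAC -nG => /eqP.
by rewrite eqf_sqr => /orP[]/eqP; [left | right].
Qed.
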